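(* (Borel Hierarchy Theorem.) (i) For every $S\in\mathbf{Hrs}$ and every $\varphi:\omega^\omega\to\omega^\omega$, if $\forall\alpha[\alpha\in\mathcal{A}_S\rightarrow\varphi|\alpha\in\mathcal{E}_S]$, then $\exists\alpha[\alpha\in\mathcal{E}_S\wedge\varphi|\alpha\in\mathcal{E}_S]$. (ii) For every $S\in\mathbf{Hrs}$ and every $\varphi:\omega^\omega\to\omega^\omega$, if $\forall\alpha[\alpha\in\mathcal{E}_S\rightarrow\varphi|\alpha\in\mathcal{A}_S]$, then $\exists\alpha[\alpha\in\mathcal{A}_S\wedge\varphi|\alpha\in\mathcal{A}_S]$.
   Context: Setting: intuitionistic mathematics (intuitionistic logic; constructive $\vee,\exists$), assuming Brouwer's Continuity Principle (for $R\subseteq\omega^\omega\times\omega$, if $\forall\alpha\exists n[\alpha Rn]$ then $\forall\alpha\exists m\exists n\forall\beta[\overline{\alpha}m\sqsubset\beta\rightarrow\beta Rn]$), the axioms of countable choice, and induction over $\mathbf{Hrs}$. Finite sequences are coded bijectively by natural numbers; $s\ast t$ concatenation, $\langle\,\rangle$ empty sequence, $\overline{\alpha}n=\langle\alpha(0),\dots,\alpha(n-1)\rangle$, $s\sqsubset\beta$ means $s$ is an initial segment of $\beta$; $(m,n)$ a fixed pairing bijection $\omega\times\omega\to\omega$. For $X\subseteq\omega$: $X\upharpoonright s=\{t\mid s\ast t\in X\}$; for $\alpha\in\omega^\omega$: $(\alpha\upharpoonright s)(t)=\alpha(s\ast t)$. $\mathbf{Hrs}$ is the least class of subsets of $\omega$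 with $1^\ast:=\{\langle\,\rangle\}\in\mathbf{Hrs}$ and, for every sequence $S_0,S_1,\dots$ in $\mathbf{Hrs}$, $\{\langle\,\rangle\}\cup\bigcup_{m,n}\langle(m,n)\rangle\ast S_n\in\mathbf{Hrs}$. Leading sets: $\mathcal{E}_{1^\ast}=\{\alpha\mid\exists n[\alpha(\langle n\rangle)\neq0]\}$, $\mathcal{A}_{1^\ast}=\{\alpha\mid\forall n[\alpha(\langle n\rangle)=0]\}$, and for $S\neq1^\ast$: $\mathcal{E}_S=\{\alpha\mid\exists n[\alpha\upharpoonright\langle n\rangle\in\mathcal{A}_{S\upharpoonright\langle n\rangle}]\}$, $\mathcal{A}_S=\{\alpha\mid\forall n[\alpha\upharpoonright\langle n\rangle\in\mathcal{E}_{S\upharpoonright\langle n\rangle}]\}$. A function $\varphi:\omega^\omega\to\omega^\omega$ is a continuous function given by a code in $\omega^\omega$ which determines each value $(\varphi|\alpha)(n)$ from a finite initial segment of $\alpha$; $\varphi|\alpha$ denotes the value at $\alpha$. *)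

(* Defs.v *)
From mathcomp Require Import all_boot.
From Stdlib.Arith Require Cantor.
From Stdlib.Logic Require ChoiceFacts.

Set Implicit Arguments.
Unset Strict Implicit.
Unset Printing Implicit Defensive.

(* The intuitionistic logic of the source is the axiom-free logic of [Prop].
   [BrouwerContinuity] below is consistent with it but contradicts excluded
   middle: what is derived from it has content only if the derivation uses no
   classical axiom. *)

Definition baire := nat -> nat.

(* Finite sequences are coded by the bijection [CodeSeq.code : seq nat -> nat];
   in particular the code of the empty sequence is [0]. *)
Definition nilc : nat := CodeSeq.code [::].
Definition sing (n : nat) : nat := CodeSeq.code [:: n].
Definition concat (s t : nat) : nat :=
  CodeSeq.code (CodeSeq.decode s ++ CodeSeq.decode t).

Definition pairing (m n : nat) : nat := Cantor.to_nat (m, n).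

Definition bar (a : baire) (n : nat) : nat := CodeSeq.code (mkseq a n).

Definition initial (s : nat) (b : baire) : Prop := exists n, bar b n = s.

(* Restriction to [s], both for subsets of [nat] ([T := Prop]) and for
   elements of Baire space ([T := nat]). *)
Definition restr (T : Type) (X : nat -> T) (s : nat) : nat -> T :=
  fun t => X (concat s t).

(* Equality of subsets of [nat] is extensional. *)
Definition seteq (X Y : nat -> Prop) : Prop := forall s, X s <-> Y s.

Definition one_star : nat -> Prop := fun s => s = nilc.

Definition concat_set (s : nat) (X : nat -> Prop) : nat -> Prop :=
  fun u => exists2 t, X t & u = concat s t.

Definition Hrs_sup (F : nat -> nat -> Prop) : nat -> Prop :=
  fun u => u = nilc \/ exists m n, concat_set (sing (pairing m n)) (F n) u.

Inductive Hrs : (nat -> Prop) -> Prop :=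
| Hrs_one_star S : seteq S one_star -> Hrs S
| Hrs_step S (F : nat -> nat -> Prop) :
    (forall n, Hrs (F n)) -> seteq S (Hrs_sup F) -> Hrs S.

(* The leading sets, by simultaneous recursion along [S]. For [S] in [Hrs] the
   recursion is well-founded, so the least solution of the defining clauses
   taken here is the only one; see [leadEP] and [leadAP]. *)
Inductive leadE : (nat -> Prop) -> baire -> Prop :=
| leadE_one S a : seteq S one_star ->
    (exists n, a (sing n) <> 0) -> leadE S a
| leadE_step S a : ~ seteq S one_star ->
    (exists n, leadA (restr S (sing n)) (restr a (sing n))) -> leadE S a
with leadA : (nat -> Prop) -> baire -> Prop :=
| leadA_one S a : seteq S one_star ->
    (forall n, a (sing n) = 0) -> leadA S a
| leadA_step S a : ~ seteq S one_star ->
    (forall n, leadE (restr S (sing n)) (restr a (sing n))) -> leadA S a.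

Lemma leadE1P S a : seteq S one_star ->
  leadE S a <-> exists n, a (sing n) <> 0.
Proof. by move=> S1; split=> [H|]; [inversion H | apply: leadE_one]. Qed.

Lemma leadA1P S a : seteq S one_star ->
  leadA S a <-> forall n, a (sing n) = 0.
Proof. by move=> S1; split=> [H|]; [inversion H | apply: leadA_one]. Qed.

Lemma leadEP S a : ~ seteq S one_star ->
  leadE S a <-> exists n, leadA (restr S (sing n)) (restr a (sing n)).
Proof. by move=> S1; split=> [H|]; [inversion H | apply: leadE_step]. Qed.

Lemma leadAP S a : ~ seteq S one_star ->
  leadA S a <-> forall n, leadE (restr S (sing n)) (restr a (sing n)).
Proof. by move=> S1; split=> [H|]; [inversion H | apply: leadA_step]. Qed.

(* A (code of a) continuous function from Baire space to itself: the value at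
   [n] on the argument [a] is read off at the first [m] where the code, at
   [<n> * bar a m], is nonzero, and is the predecessor of the number found. *)
Record cfun := CFun {
  cfun_code : baire;
  cfun_total : forall (a : baire) (n : nat),
    exists m, cfun_code (concat (sing n) (bar a m)) != 0
}.

Definition capp (phi : cfun) (a : baire) : baire := fun n =>
  (cfun_code phi
     (concat (sing n) (bar a (ex_minn (cfun_total phi a n))))).-1.

Definition BrouwerContinuity : Prop :=
  forall R : baire -> nat -> Prop,
    (forall a, exists n, R a n) ->
    forall a, exists m n, forall b, initial (bar a m) b -> R b n.

(* Choice for sequences of numbers and for sequences of elements of Baire
   space. *)
Definition CountableChoice : Prop :=
  ChoiceFacts.FunctionalChoice_on nat nat /\
  ChoiceFacts.FunctionalChoice_on nat baire.

(* Main.v *)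
(* The sets E_S and A_S are retracts of Baire space, so Brouwer's principle
   applies to quantifiers ranging over them. If phi maps A_S into E_S, it gives
   a number j and finitely many conditions on a such that (phi|a)^j is in
   A_(S|j) for every a in A_S meeting them. Every subset occurring in S recurs
   infinitely often, so the conditions leave some coordinate j' with S|j' = S|j
   untouched; fixing the other coordinates, we see that the passage from a^j' to
   (phi|a)^j maps E_(S|j) into A_(S|j), and (i) for S follows from (ii) for S|j.
   If phi maps E_S into A_S, then for each i the passage from a^i to (phi|a)^i
   maps A_(S|i) into E_(S|i), whatever the other coordinates are. All these
   problems must be solved by one and the same a: it is built as a generic
   point, a limit of finite conditions. Each application of Brouwer's principle
   is centred at the condition reached so far and only extends it. As dependent
   choice is not available, the answers to all conditions are chosen beforehand,
   by recursion on S, and collected in a strategy. *)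

From mathcomp Require Import all_boot.
From Stdlib.Arith Require Cantor.
From Stdlib.Logic Require ChoiceFacts.
Require Import Defs.

Set Implicit Arguments.
Unset Strict Implicit.
Unset Printing Implicit Defensive.

Arguments CodeSeq.code : simpl never.
Arguments CodeSeq.decode : simpl never.

(** * Restrictions to cylinders *)

Definition sect (x : baire) (w : seq nat) : baire :=
  fun t => x (CodeSeq.code (w ++ CodeSeq.decode t)).

Lemma sect_nil x : sect x [::] =1 x.
Proof. by move=> t; rewrite /sect /= CodeSeq.decodeK. Qed.

Lemma sect_cat x v w : sect (sect x v) w =1 sect x (v ++ w).
Proof. by move=> t; rewrite /sect CodeSeq.codeK catA. Qed.

Lemma sect_rcons x w k : sect (sect x w) [:: k] =1 sect x (rcons w k).
Proof. by rewrite -cats1; apply: sect_cat. Qed.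

Lemma eq_sect x y w : x =1 y -> sect x w =1 sect y w.
Proof. by move=> exy t; apply: exy. Qed.

Lemma restr_sing (x : baire) k : restr x (sing k) =1 sect x [:: k].
Proof. by move=> t; rewrite /restr /concat /sing CodeSeq.codeK. Qed.

Definition glue (n : nat) (f : nat -> baire) : baire := fun s =>
  if CodeSeq.decode s is k :: t then f k (CodeSeq.code t) else n.

Lemma sect_glue n f k : sect (glue n f) [:: k] =1 f k.
Proof.
by move=> t; rewrite /sect /glue CodeSeq.codeK /= CodeSeq.decodeK.
Qed.

Lemma glue_nilc n f : glue n f nilc = n.
Proof. by rewrite /glue /nilc CodeSeq.codeK. Qed.

Lemma mem_code_lt k s : k \in s -> k < CodeSeq.code s.
Proof. by move=> ks; apply: (allP (CodeSeq.ltn_code s)). Qed.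

Lemma code_cat_ge v s : CodeSeq.code s <= CodeSeq.code (v ++ s).
Proof.
elim: v => //= k v IHv; apply: leq_trans IHv _.
rewrite -[X in X <= _]mul1n leq_mul ?expn_gt0 // -addnn.
by rewrite -addnS leq_addr.
Qed.

(** * Leading sets of well-founded trees *)

Inductive tree : Type := Leaf | Node of (nat -> tree).

(* The [k]-th child of [Node F] is [F (idx k)], so that every [F n] occurs
   infinitely often among the children. *)
Definition idx (k : nat) : nat := (Cantor.of_nat k).2.

Lemma idx_pairing m n : idx (pairing m n) = n.
Proof. by rewrite /idx /pairing Cantor.cancel_of_to. Qed.

Lemma pairing_ge m n : m <= pairing m n.
Proof.
have /leP := Cantor.to_nat_non_decreasing m n.
by rewrite plusE; apply: leq_trans; apply: leq_addl.
Qed.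

Fixpoint EE (T : tree) (a : baire) : Prop :=
  match T with
  | Leaf => exists n, a (CodeSeq.code [:: n]) <> 0
  | Node F => exists k, AA (F (idx k)) (sect a [:: k])
  end
with AA (T : tree) (a : baire) : Prop :=
  match T with
  | Leaf => forall n, a (CodeSeq.code [:: n]) = 0
  | Node F => forall k, EE (F (idx k)) (sect a [:: k])
  end.

Lemma eq_EA T a b : a =1 b -> (EE T a -> EE T b) /\ (AA T a -> AA T b).
Proof.
elim: T a b => [|F IH] a b eab /=.
  by split=> [[n]|an0 n]; [exists n | ]; rewrite -eab.
split=> [[k Ak]|Ea k].
  by exists k; apply: (IH _ _ _ (eq_sect _ eab)).2.
by apply: (IH _ _ _ (eq_sect _ eab)).1.
Qed.

Lemma eq_EE T a b : a =1 b -> EE T a -> EE T b.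
Proof. by move=> eab; apply: (eq_EA T eab).1. Qed.

Lemma eq_AA T a b : a =1 b -> AA T a -> AA T b.
Proof. by move=> eab; apply: (eq_EA T eab).2. Qed.

(** * From [Hrs] to trees *)

Lemma seteq_sym X Y : seteq X Y -> seteq Y X.
Proof. by move=> XY s; split=> /XY. Qed.

Lemma seteq_trans X Y Z : seteq X Y -> seteq Y Z -> seteq X Z.
Proof.
by move=> XY YZ s; split=> [/XY /YZ|/YZ /XY].
Qed.

Lemma restr_seteq (X Y : nat -> Prop) s :
  seteq X Y -> seteq (restr X s) (restr Y s).
Proof. by move=> XY t; apply: XY. Qed.

Lemma Hrs_nilc S : Hrs S -> S nilc.
Proof. by case=> [S' ->|S' F _ ->]; [| left]. Qed.

Lemma Hrs_seteq S S' : seteq S S' -> Hrs S -> Hrs S'.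
Proof.
move=> SS' HS; case: HS SS' => [X X1|X F HF XF] XS'.
  exact: Hrs_one_star (seteq_trans (seteq_sym XS') X1).
exact: Hrs_step HF (seteq_trans (seteq_sym XS') XF).
Qed.

Lemma restr_Hrs_sup F m n :
  seteq (restr (Hrs_sup F) (sing (pairing m n))) (F n).
Proof.
move=> t; rewrite /restr /Hrs_sup /concat /sing CodeSeq.codeK.
split; last first.
  move=> Fnt; right; exists m, n; exists t => //.
  by rewrite /concat CodeSeq.codeK.
case=> [|[m' [n' [t' Ft' ]]]].
  by move/(congr1 CodeSeq.decode); rewrite !CodeSeq.codeK.
move/(congr1 CodeSeq.decode); rewrite /concat !CodeSeq.codeK.
case=> /(congr1 idx); rewrite !idx_pairing => -> /(can_inj CodeSeq.decodeK) ->.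
exact: Ft'.
Qed.

Lemma Hrs_step_not_one S F :
  (forall n, Hrs (F n)) -> seteq S (Hrs_sup F) -> ~ seteq S one_star.
Proof.
move=> HF SF S1; have : Hrs_sup F (sing (pairing 0 0)).
  right; exists 0, 0; exists nilc; first exact: Hrs_nilc.
  by rewrite /concat !CodeSeq.codeK cats0.
by move/SF/S1/(congr1 CodeSeq.decode); rewrite !CodeSeq.codeK.
Qed.

Lemma lead_seteq S S' a : Hrs S -> seteq S S' ->
  (leadE S a <-> leadE S' a) /\ (leadA S a <-> leadA S' a).
Proof.
move=> HS; elim: HS S' a => {S} [S S1|S F HF IH SF] S' a SS'.
  have S'1 := seteq_trans (seteq_sym SS') S1.
  rewrite (leadE1P a S1) (leadE1P a S'1) (leadA1P a S1) (leadA1P a S'1).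
  by split.
have nS1 := Hrs_step_not_one HF SF.
have S'F := seteq_trans (seteq_sym SS') SF.
have nS'1 := Hrs_step_not_one HF S'F.
have kidP k b :
    (leadE (restr S (sing k)) b <-> leadE (restr S' (sing k)) b) /\
    (leadA (restr S (sing k)) b <-> leadA (restr S' (sing k)) b).
  have ek : k = pairing (Cantor.of_nat k).1 (Cantor.of_nat k).2.
    by rewrite /pairing -surjective_pairing Cantor.cancel_to_of.
  have FS Z : seteq Z (Hrs_sup F) -> seteq (F (idx k)) (restr Z (sing k)).
    move=> ZF; apply: seteq_sym; rewrite ek idx_pairing.
    exact: seteq_trans (restr_seteq _ ZF) (restr_Hrs_sup _ _ _).
  have [E1 A1] := IH _ _ b (FS _ SF); have [E2 A2] := IH _ _ b (FS _ S'F).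
  by split; [rewrite -E1 E2 | rewrite -A1 A2].
rewrite (leadEP a nS1) (leadEP a nS'1) (leadAP a nS1) (leadAP a nS'1).
split; [split=> [] [k Hk]; exists k | split=> Hk k].
- exact/(kidP k _).2.
- exact/(kidP k _).2.
- exact/(kidP k _).1.
- exact/(kidP k _).1.
Qed.

(* [c] tells which nodes of [S] are leaves. Having a single constructor whose
   arguments are propositions, [coded S c] can be eliminated into [Type]: this
   is what turns the proposition [Hrs S] into a tree. *)
Inductive coded (S : nat -> Prop) (c : baire) : Prop := Coded of
  Hrs S &
  (c nilc = 0 -> seteq S one_star) &
  (c nilc <> 0 -> ~ seteq S one_star) &
  (c nilc <> 0 -> forall m n,
    seteq (restr S (sing (pairing 0 n))) (restr S (sing (pairing m n)))) &
  (c nilc <> 0 -> forall n,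
    coded (restr S (sing (pairing 0 n))) (restr c (sing n))).

Lemma coded_eq S c S' c' :
  coded S c -> seteq S S' -> c =1 c' -> coded S' c'.
Proof.
move=> HS; elim: HS S' c' => {}S {}c HS c0 c1 Sm _ IH S' c' SS' cc'.
constructor; rewrite -?cc'.
- exact: Hrs_seteq SS' HS.
- by move=> c_nil; exact: seteq_trans (seteq_sym SS') (c0 c_nil).
- by move=> c_nil S'1; apply: (c1 c_nil); exact: seteq_trans SS' S'1.
- move=> c_nil m n; apply: seteq_trans (restr_seteq _ SS').
  exact: seteq_trans (seteq_sym (restr_seteq _ SS')) (Sm c_nil m n).
- move=> cn n; apply: IH => //; first exact: restr_seteq.
  by move=> t; rewrite /restr cc'.
Qed.

(** The labelling is a point of Baire space, so that countable choice can collect the labellings of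
    all the [F n]. *)
Lemma Hrs_coded S : CountableChoice -> Hrs S -> exists c, coded S c.
Proof.
move=> [_ AC]; elim=> {S} [S S1|S F HF IH SF].
  exists (fun=> 0); constructor=> //.
  exact: Hrs_one_star.
have /AC [c cF] := IH.
have SFn m n : seteq (restr S (sing (pairing m n))) (F n).
  exact: seteq_trans (restr_seteq _ SF) (restr_Hrs_sup _ _ _).
exists (glue 1 c).
constructor=> [||_|_ m n|_ n].
- exact: Hrs_step SF.
- by rewrite glue_nilc.
- exact: Hrs_step_not_one SF.
- exact: seteq_trans (SFn 0 n) (seteq_sym (SFn m n)).
- apply: coded_eq (cF n) (seteq_sym (SFn 0 n)) _ => t.
  by rewrite restr_sing sect_glue.
Qed.

Lemma tree_of_coded S c : coded S c ->
  {T : tree | forall a, (leadE S a <-> EE T a) /\ (leadA S a <-> AA T a)}.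
Proof.
elim=> {}S {}c HS c0 c1 Sm cS IH.
have [cn|/eqP cn] := eqVneq (c nilc) 0.
  exists Leaf => a /=; rewrite (leadE1P a (c0 cn)) (leadA1P a (c0 cn)).
  by split.
exists (Node (fun n => sval (IH cn n))) => a /=.
rewrite (leadEP a (c1 cn)) (leadAP a (c1 cn)).
have kidP k :
    (leadE (restr S (sing k)) (restr a (sing k)) <->
       EE (sval (IH cn (idx k))) (sect a [:: k])) /\
    (leadA (restr S (sing k)) (restr a (sing k)) <->
       AA (sval (IH cn (idx k))) (sect a [:: k])).
  have ek : k = pairing (Cantor.of_nat k).1 (Cantor.of_nat k).2.
    by rewrite /pairing -surjective_pairing Cantor.cancel_to_of.
  have HSk : Hrs (restr S (sing (pairing 0 (idx k)))) by case: (cS cn (idx k)).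
  have := Sm cn (Cantor.of_nat k).1 (Cantor.of_nat k).2; rewrite -ek => Sk.
  have [E1 A1] := lead_seteq (restr a (sing k)) HSk Sk.
  have [E2 A2] := svalP (IH cn (idx k)) (restr a (sing k)).
  have as1 := restr_sing a k.
  have as2 : sect a [:: k] =1 restr a (sing k) by move=> t.
  rewrite -E1 -A1 E2 A2; split; split.
  - exact: eq_EE.
  - exact: eq_EE.
  - exact: eq_AA.
  - exact: eq_AA.
split; [split=> [] [k Hk]; exists k | split=> Hk k].
- exact/(kidP k).2.
- exact/(kidP k).2.
- exact/(kidP k).1.
- exact/(kidP k).1.
Qed.

(** * Continuity *)

Definition agree (m : nat) (x y : baire) : Prop :=
  forall s, s < m -> x s = y s.

Lemma BCP_agree (R : baire -> nat -> Prop) :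
  BrouwerContinuity -> (forall a, exists n, R a n) ->
  forall a, exists m n, forall b, agree m a b -> R b n.
Proof.
move=> BCP Rt a; have [m [n Hmn]] := BCP R Rt a.
exists m, n => b ab; apply: Hmn; exists m; rewrite /bar; congr CodeSeq.code.
by apply/eq_in_map=> s; rewrite mem_iota add0n => /ab.
Qed.

Lemma BCP_cont (f : baire -> nat) x : BrouwerContinuity ->
  exists m, forall y, agree m x y -> f y = f x.
Proof.
move=> BCP; have /(BCP_agree BCP)/(_ x) [m [n fn]] a : exists n, f a = n.
  by exists (f a).
by exists m => y xy; rewrite (fn y xy) (fn x).
Qed.

(** Continuity makes every function respect pointwise equality, which stands in for functional
    extensionality. *)
Lemma BCP_ext (f : baire -> baire) x y : BrouwerContinuity ->
  x =1 y -> f x =1 f y.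
Proof.
move=> BCP exy s; have [m fm] := BCP_cont (f^~ s) y BCP.
by apply: fm => t _.
Qed.

(** * The leading sets as retracts of Baire space *)

(* [retrE T g x] corrects [x] so that it obeys the strategy [g] for membership
   in [EE T]; [retrA] likewise for [AA T]. *)
Fixpoint retrE (T : tree) (g x : baire) : baire :=
  match T with
  | Leaf => fun s =>
      if s == CodeSeq.code [:: g 0] then (x s).-1.+1 else x s
  | Node F => glue (x nilc) (fun k =>
      if k == g 0 then retrA (F (idx k)) (sect g [:: 0]) (sect x [:: k])
      else sect x [:: k])
  end
with retrA (T : tree) (g x : baire) : baire :=
  match T with
  | Leaf => fun s => if size (CodeSeq.decode s) == 1 then 0 else x s
  | Node F => glue (x nilc) (fun k =>
      retrE (F (idx k)) (sect g [:: k]) (sect x [:: k]))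
  end.

Lemma eq_glue n f f' : (forall k, f k =1 f' k) -> glue n f =1 glue n f'.
Proof.
move=> ff' s; rewrite /glue.
by case: (CodeSeq.decode s) => [|k t]; rewrite ?ff'.
Qed.

Lemma glue_sect x : glue (x nilc) (fun k => sect x [:: k]) =1 x.
Proof.
move=> s; rewrite /glue /sect -[s in RHS]CodeSeq.decodeK.
by case: (CodeSeq.decode s) => // k t; rewrite CodeSeq.codeK.
Qed.

Lemma retr_ext T g g' x x' : g =1 g' -> x =1 x' ->
  retrE T g x =1 retrE T g' x' /\ retrA T g x =1 retrA T g' x'.
Proof.
elim: T g g' x x' => [|F IH] g g' x x' eg ex /=.
  by split=> s /=; rewrite ?eg !ex.
split; rewrite ex; apply: eq_glue => k.
  rewrite eg; case: eqP => [->|_]; last exact: eq_sect.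
  by apply: (IH _ _ _ _ _ _ _).2; apply: eq_sect.
by apply: (IH _ _ _ _ _ _ _).1; apply: eq_sect.
Qed.

Lemma retr_sound T g x : EE T (retrE T g x) /\ AA T (retrA T g x).
Proof.
elim: T g x => [|F IH] g x /=.
  by split=> [|n]; [exists (g 0); rewrite eqxx | rewrite CodeSeq.codeK].
split=> [|k].
  exists (g 0).
  apply: eq_AA (IH (idx (g 0)) (sect g [:: 0]) (sect x [:: g 0])).2.
  by move=> t; rewrite sect_glue eqxx.
apply: eq_EE (IH (idx k) (sect g [:: k]) (sect x [:: k])).1.
by move=> t; rewrite sect_glue.
Qed.

(** The strategy records the witnesses of membership; the retraction then has nothing to correct. *)
Lemma retr_complete T x : CountableChoice ->
  (EE T x -> exists g, retrE T g x =1 x) /\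
  (AA T x -> exists g, retrA T g x =1 x).
Proof.
move=> [_ AC]; elim: T x => [|F IH] x /=.
  split=> [[n xn]|xA]; [exists (fun=> n) | exists x] => s.
    (* [.-1.+1] changes only the value 0, and [x] is nonzero at this position. *)
    by case: eqP => // ->; rewrite prednK // lt0n; apply/eqP.
  case: ifP => //; rewrite -[s in RHS]CodeSeq.decodeK.
  by case: (CodeSeq.decode s) => [|n [|]] //= _; rewrite xA.
split=> [[k /(IH _ _).2 [g gx]]|xA].
  (* Since 0 codes the empty sequence, the chosen child [k] is read off as [g 0]. *)
  exists (glue k (fun=> g)) => s; rewrite -[RHS]glue_sect.
  apply: eq_glue => l t; rewrite glue_nilc.
  case: eqP => // ->; rewrite -gx.
  by apply: (retr_ext _ _ _).2 => //; apply: sect_glue.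
have /AC [g gx] k : exists g,
    retrE (F (idx k)) g (sect x [:: k]) =1 sect x [:: k].
  exact: (IH _ _).1.
exists (glue 0 g) => s; rewrite -[RHS]glue_sect; apply: eq_glue => k t.
by rewrite -gx; apply: (retr_ext _ _ _).1 => //; apply: sect_glue.
Qed.

(* [std true] and [std false] belong to all [EE T] and all [AA T],
   respectively, since the depth of a leaf determines which player owns it. *)
Definition std (b : bool) (l : nat) : nat := (b == odd l).

Lemma std_lead T x :
  (forall m, (forall s, m <= s -> x s = std true (size (CodeSeq.decode s))) ->
     EE T x) /\
  ((forall s, x s = std false (size (CodeSeq.decode s))) -> AA T x).
Proof.
elim: T x => [|F IH] x /=; split=> [m xm|xs k]; last 1 first.
- apply: (IH _ _).1 0 _ => s _.
  by rewrite /sect xs CodeSeq.codeK /std /=; case: odd.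
- exists m; rewrite xm ?CodeSeq.codeK //.
  by apply: ltnW; apply: mem_code_lt; rewrite inE.
- by rewrite xs CodeSeq.codeK.
(* Codes of sequences that begin with [m] exceed [m], so this section is standard everywhere. *)
exists m; apply: (IH _ _).2 => s.
rewrite /sect xm ?CodeSeq.codeK /std /=; first by case: odd.
by apply: ltnW; apply: mem_code_lt; rewrite inE eqxx.
Qed.

(** * Conditions *)

Definition incomp (u v : seq nat) : bool := ~~ prefix u v && ~~ prefix v u.

Lemma prefix_comparable (u v d : seq nat) :
  prefix u d -> prefix v d -> prefix u v || prefix v u.
Proof.
elim: u v d => [|a u IHu] [|b v] [|c d] //.
rewrite !prefix_cons => /andP [/eqP -> ud] /andP [/eqP -> vd].
by rewrite eqxx /=; apply: IHu ud vd.
Qed.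

Lemma incomp_sym u v : incomp u v = incomp v u.
Proof. by rewrite /incomp andbC. Qed.

Lemma incomp_prefix u u' v : prefix u u' -> incomp u v -> incomp u' v.
Proof.
move=> uu' /andP [nuv nvu]; apply/andP; split; apply/negP.
  by move/(prefix_trans uu'); apply/negP.
by move/prefix_comparable/(_ uu'); rewrite (negbTE nuv) (negbTE nvu).
Qed.

(* The event [Some (u, (m, j, b))] fixes a point outside the cylinder of
   [rcons u j] within the cylinder of [u], so that the point enters [EE] at [u]
   whatever happens elsewhere if [u] is a leaf ([b = true]), and as soon as it
   enters [AA] at [rcons u j] otherwise ([b = false]). It also fixes the values
   below [m]. *)
Definition event := option (seq nat * (nat * nat * bool)).

Definition region (e : event) (d : seq nat) : bool :=
  if e is Some (u, (_, j, _)) then prefix u d && ~~ prefix (rcons u j) d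
  else false.

Definition frozen (h : seq event) (s : nat) : bool :=
  has (region^~ (CodeSeq.decode s)) h.

Fixpoint len (h : seq event) : nat :=
  if h is e :: h' then
    maxn (if e is Some (_, (m, _, _)) then m else 0) (len h').+1
  else 0.

(** An event writes only to positions not yet determined; untouched ones keep the default 0. A leaf
    event also spares those below [m], so that continuity at the previous point still applies. *)
Fixpoint pt (h : seq event) (s : nat) : nat :=
  if h is e :: h' then
    if [&& len h' <= s, ~~ frozen h' s & region e (CodeSeq.decode s)] then
      if e is Some (u, (m, _, b)) then
        if b && (s < m) then pt h' s
        else std b (size (CodeSeq.decode s) - size u)
      else pt h' s
    else pt h' s
  else 0.

Definition compat (h : seq event) (x : baire) : Prop :=
  agree (len h) (pt h) x /\ forall s, frozen h s -> x s = pt h s.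

Lemma frozen_suffix h h' s : suffix h h' -> frozen h s -> frozen h' s.
Proof. by case/suffixP=> l ->; rewrite /frozen has_cat => ->; rewrite orbT. Qed.

Lemma len_suffix h h' : suffix h h' -> len h <= len h'.
Proof.
case/suffixP=> l ->; elim: l => //= e l IHl; apply: leq_trans IHl _.
by rewrite leq_max leqnSn orbT.
Qed.

Lemma pt_suffix h h' s :
  suffix h h' -> (s < len h) || frozen h s -> pt h' s = pt h s.
Proof.
case/suffixP=> l -> hs; elim: l => //= e l <-; case: ifP => //.
case/and3P=> le_s nfr _; case/orP: hs => [lt_s|fr]; last first.
  by rewrite (frozen_suffix (suffix_suffix l h)) in nfr.
have le_len := len_suffix (suffix_suffix l h).
by have := leq_trans lt_s (leq_trans le_len le_s); rewrite ltnn.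
Qed.

Lemma compat_pt h : compat h (pt h). Proof. by split. Qed.

Lemma compat_suffix h h' x : suffix h h' -> compat h' x -> compat h x.
Proof.
move=> hh' [ag fr]; split=> s hs.
  rewrite -(ag s) ?(pt_suffix hh') ?hs //.
  exact: leq_trans hs (len_suffix hh').
by rewrite fr ?(frozen_suffix hh') // (pt_suffix hh') // hs orbT.
Qed.

(** Beyond its finite segment the event prescribes nothing in the cylinder of [v], which lies below
    the child left free or is disjoint from the cylinder of [u]. *)
Definition fresh1 (v : seq nat) (e : event) : bool :=
  if e is Some (u, (_, j, _)) then prefix (rcons u j) v || incomp u v
  else true.

Definition fresh (h : seq event) (v : seq nat) : bool := all (fresh1 v) h.

Lemma fresh1_prefix v v' e : prefix v v' -> fresh1 v e -> fresh1 v' e.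
Proof.
case: e => [[u [[m j] b]]|] //= vv' /orP [uv|uv]; apply/orP.
  by left; apply: prefix_trans uv vv'.
by right; rewrite incomp_sym; apply: incomp_prefix vv' _; rewrite incomp_sym.
Qed.

Lemma fresh_prefix h v v' : prefix v v' -> fresh h v -> fresh h v'.
Proof. by move=> vv'; apply: sub_all => e; apply: fresh1_prefix. Qed.

Lemma fresh_frozen h v s :
  fresh h v -> prefix v (CodeSeq.decode s) -> frozen h s = false.
Proof.
move=> fr vs; apply/negP => /hasP [e he]; have := allP fr e he.
case: e {he} => [[u [[m j] b]]|] //= /orP [uv|/andP [nuv nvu]] /andP [us njs].
  by rewrite (prefix_trans uv vs) in njs.
by move: (prefix_comparable us vs); rewrite (negbTE nuv) (negbTE nvu).
Qed.

Lemma fresh_pt h v s :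
  fresh h v -> prefix v (CodeSeq.decode s) -> pt h s = 0.
Proof.
move=> + vs; elim: h => //= e h IHh /andP [fe fh]; rewrite IHh //.
have := @fresh_frozen [:: e] v s; rewrite /= fe orbF => /(_ isT vs) ->.
by rewrite !andbF.
Qed.

(** * Strategies *)

(** Position 0 of a strategy holds a tag or the first move. Conditions are countable, so the answers
    to all pairs of child and condition fit in the other positions. *)
Definition substrat (i : nat) (h : seq event) (s : baire) : baire :=
  fun t => s (pickle (i, h, t)).+1.

Definition next_strat (s : baire) : baire := fun t => s t.+1.

(* [stratA T h w Psi s]: from the condition [h] on, [s] tells how to bring both
   the section at [w] of the generic point and its image under [Psi] into
   [AA T]. [stratE T h u Psi s] is the analogue for [EE T], where [s] starts
   with an event at [u]. *)
Fixpoint stratA (T : tree) (h : seq event) (w : seq nat)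
    (Psi : baire -> baire) (s : baire) : Prop :=
  match T with
  | Leaf => s 0 = 0 /\
      forall x, compat h x -> EE Leaf (sect x w) -> AA Leaf (Psi x)
  | Node F => s 0 <> 0 /\
      forall i h', suffix h h' -> fresh h' (rcons w i) ->
        stratE (F (idx i)) h' (rcons w i) (fun x => sect (Psi x) [:: i])
          (substrat i h' s)
  end
with stratE (T : tree) (h : seq event) (u : seq nat)
    (Psi : baire -> baire) (s : baire) : Prop :=
  exists m j,
  match T with
  | Leaf => unpickle (s 0) = Some (m, j, true) /\
      forall x, compat (Some (u, (m, j, true)) :: h) x -> EE Leaf (Psi x)
  | Node F => unpickle (s 0) = Some (m, j, false) /\
      exists2 j', idx j' = idx j &
        stratA (F (idx j)) (Some (u, (m, j, false)) :: h) (rcons u j)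
          (fun x => sect (Psi x) [:: j']) (next_strat s)
  end.

Lemma strat_ext T s s' : s =1 s' ->
  (forall h w Psi, stratA T h w Psi s -> stratA T h w Psi s') /\
  (forall h u Psi, stratE T h u Psi s -> stratE T h u Psi s').
Proof.
elim: T s s' => [|F IH] s s' es; split=> h w Psi /=; rewrite ?es //.
- move=> [s0 Hs]; split=> // i h' hh' fh'.
  by apply: (IH _ _ _ _).2 (Hs i h' hh' fh') => t; apply: es.
- move=> [m [j [s0 [j' ejj' Hs]]]]; exists m, j; split=> //; exists j' => //.
  by apply: (IH _ _ _ _).1 Hs => t; apply: es.
Qed.

(** * Brouwer's principle centred at a condition *)

Definition evens (c : baire) : baire := fun t => c t.*2.
Definition odds (c : baire) : baire := fun t => c t.*2.+1.
Definition interleave (g x : baire) : baire :=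
  fun s => if odd s then x s./2 else g s./2.

Lemma evens_interleave g x : evens (interleave g x) =1 g.
Proof. by move=> t; rewrite /evens /interleave odd_double doubleK. Qed.

Lemma odds_interleave g x : odds (interleave g x) =1 x.
Proof.
by move=> t; rewrite /odds /interleave /= odd_double uphalf_double.
Qed.

Lemma agree_interleave m g g' x x' : agree m g g' -> agree m x x' ->
  agree m (interleave g x) (interleave g' x').
Proof.
move=> gg xx s sm; rewrite /interleave.
have hs : s./2 < m.
  by apply: leq_ltn_trans sm; rewrite leq_half_double -addnn -addnS leq_addr.
by rewrite gg // xx.
Qed.

(** The centre for Brouwer's principle: for fresh [u] it extends [h], and its section at [u] is in
    every [AA (Node F)]. *)
Definition std_pt (h : seq event) (u : seq nat) : baire := fun s =>
  if prefix u (CodeSeq.decode s) && (len h <= s)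
  then std false (size (CodeSeq.decode s) - size u) else pt h s.

Definition obey (F : nat -> tree) (h : seq event) (u : seq nat)
    (g x : baire) : baire := fun s =>
  if prefix u (CodeSeq.decode s) then
    glue (x (CodeSeq.code u))
      (fun k => retrE (F (idx k)) (sect g [:: k]) (sect x (rcons u k)))
      (CodeSeq.code (drop (size u) (CodeSeq.decode s)))
  else if frozen h s then pt h s else x s.

(* Whether [obey F h u g x] extends the finite segment prescribed by [h] is
   decidable, which makes [param] total without restricting [c]. *)
Definition param (F : nat -> tree) (h : seq event) (u : seq nat)
    (c : baire) : baire :=
  let z := obey F h u (evens c) (odds c) in
  if all (fun s => z s == pt h s) (iota 0 (len h)) then z else std_pt h u.

Lemma sect_obey F h u g x k : sect (obey F h u g x) (rcons u k) =1
  retrE (F (idx k)) (sect g [:: k]) (sect x (rcons u k)).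
Proof.
move=> t; rewrite {1}/sect /obey CodeSeq.codeK cat_rcons prefix_prefix.
by rewrite drop_size_cat // /glue CodeSeq.codeK CodeSeq.decodeK.
Qed.

Lemma EE_std_pt F h u k : EE (F (idx k)) (sect (std_pt h u) (rcons u k)).
Proof.
apply: (std_lead _ _).1 (len h) _ => s le_s.
rewrite /sect /std_pt CodeSeq.codeK cat_rcons prefix_prefix -cat_rcons.
rewrite (leq_trans le_s) /=; last first.
  by rewrite -[X in X <= _]CodeSeq.decodeK code_cat_ge.
rewrite size_cat size_rcons addSn subSn ?leq_addr // addKn /std /=.
by case: odd.
Qed.

Lemma compat_param F h u c : fresh h u -> compat h (param F h u c).
Proof.
move=> fresh_u; rewrite /param; case: ifP => [/allP zh|_]; split=> s hs.
- by apply/esym/eqP/zh; rewrite mem_iota.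
- rewrite /obey hs; case: ifP => // us.
  by rewrite (fresh_frozen fresh_u us) in hs.
- by rewrite /std_pt leqNgt hs andbF.
- rewrite /std_pt; case: ifP => // /andP [us _].
  by rewrite (fresh_frozen fresh_u us) in hs.
Qed.

Lemma AA_param F h u c : AA (Node F) (sect (param F h u c) u).
Proof.
move=> k; apply: eq_EE (fsym (@sect_rcons _ _ _)) _.
rewrite /param; case: ifP => _; last exact: EE_std_pt.
exact: eq_EE (fsym (@sect_obey _ _ _ _ _ _)) (retr_sound _ _ _).1.
Qed.

Lemma std_pt_off h u m j x s : fresh h u ->
  compat (Some (u, (m, j, false)) :: h) x ->
  ~~ prefix (rcons u j) (CodeSeq.decode s) ->
  prefix u (CodeSeq.decode s) || (s < m) -> x s = std_pt h u s.
Proof.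
move=> fresh_u [ag fr] js; rewrite /std_pt.
have [us _|nus /= sm] := boolP (prefix u _).
  rewrite fr /= ?js ?us //=.
  by rewrite (fresh_frozen fresh_u us) /= andbT.
by rewrite -ag /= ?(negbTE nus) ?andbF // leq_max sm.
Qed.

(** [j] is a coordinate of the argument, [j'] one of the image. Taking [j] as [pairing m (idx j')]
    gives the same subtree at both and puts the cylinder at [j] beyond the modulus [m]. *)
Lemma node_step F h u Psi : BrouwerContinuity -> CountableChoice ->
  fresh h u ->
  (forall x, compat h x -> AA (Node F) (sect x u) -> EE (Node F) (Psi x)) ->
  exists m j j', idx j' = idx j /\
    forall x, compat (Some (u, (m, j, false)) :: h) x ->
      EE (F (idx j)) (sect x (rcons u j)) ->
      AA (F (idx j)) (sect (Psi x) [:: j']).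
Proof.
move=> BCP CC fresh_u HPsi.
have /CC.2 [G GP] k : exists g,
    retrE (F (idx k)) g (sect (std_pt h u) (rcons u k)) =1
    sect (std_pt h u) (rcons u k).
  exact: (retr_complete _ _ CC).1 (EE_std_pt F h u k).
have /(BCP_agree BCP) :=
  fun c => HPsi _ (compat_param F c fresh_u) (AA_param F h u c).
move=> /(_ (interleave (glue 0 G) (std_pt h u))) [m [j' Hm]].
exists m, (pairing m (idx j')), j'; rewrite idx_pairing; split=> //.
have := pairing_ge m (idx j'); have := idx_pairing m (idx j').
set j := pairing _ _ => ij le_mj x cx; rewrite -ij.
move=> /(retr_complete _ _ CC).1 [g1 g1P]; rewrite ij.
(* Only the strategy at child [j] changes, which is invisible below [m]. *)
pose g := glue 0 (fun k => if k == j then g1 else G k).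
have notin s l : s < m -> j \in l -> CodeSeq.code l != s.
  move=> sm /mem_code_lt jl; rewrite gtn_eqF //.
  exact: leq_trans sm (leq_trans le_mj (ltnW jl)).
have ag : agree m (interleave (glue 0 G) (std_pt h u)) (interleave g x).
  apply: agree_interleave => s sm.
    rewrite /g /glue; case Ds: (CodeSeq.decode s) => [|k t] //.
    case: eqP => // ekj; have := notin s (k :: t) sm; rewrite ekj mem_head.
    by rewrite -ekj -Ds CodeSeq.decodeK eqxx => /(_ isT).
  apply/esym/(std_pt_off fresh_u cx); last by rewrite sm orbT.
  apply/negP => /prefixP [t Ds]; have := notin s (rcons u j ++ t) sm.
  by rewrite mem_cat mem_rcons mem_head -Ds CodeSeq.decodeK eqxx => /(_ isT).
have {Hm} := Hm _ ag; apply: eq_AA; apply: eq_sect; apply: (BCP_ext _ BCP).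
set c := interleave g x.
have suf : suffix h (Some (u, (m, j, false)) :: h).
  exact: suffix_suffix [:: _] h.
(* [obey] fixes [x]: [g1] serves the child [j], and [G] the others, where [x] is standard. *)
have zx : obey F h u (evens c) (odds c) =1 x.
  move=> s; rewrite /obey; case: ifP => [/prefixP [t Ds]|us]; last first.
    case: ifP => fs; last exact: odds_interleave.
    by have [_ ->] := compat_suffix suf cx.
  rewrite Ds drop_size_cat // /glue CodeSeq.codeK.
  have es : s = CodeSeq.code (u ++ t) by rewrite -Ds CodeSeq.decodeK.
  case: t Ds es => [|k t] Ds es.
    by rewrite odds_interleave es cats0.
  transitivity (sect x (rcons u k) (CodeSeq.code t)); last first.
    by rewrite es /sect CodeSeq.codeK cat_rcons.
  have eg : sect (evens c) [:: k] =1 if k == j then g1 else G k.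
    move=> r; rewrite (eq_sect _ (@evens_interleave _ _)).
    exact: sect_glue.
  rewrite ((retr_ext _ eg (eq_sect _ (@odds_interleave _ _))).1 _).
  have [ekj|nkj] := eqVneq k j; first by rewrite ekj g1P.
  have xs : sect x (rcons u k) =1 sect (std_pt h u) (rcons u k).
    move=> r; apply: (std_pt_off fresh_u cx); rewrite CodeSeq.codeK cat_rcons.
      by rewrite -cats1 prefix_catr // prefix_cons prefix0s eqxx andbT eq_sym.
    by rewrite prefix_prefix.
  by rewrite ((retr_ext _ (frefl _) xs).1 _) GP xs.
rewrite /param; case: ifP => // /negP [].
apply/allP => s; rewrite mem_iota add0n => /= sh; rewrite zx.
by have [agx _] := compat_suffix suf cx; rewrite agx.
Qed.

Lemma strat_exists T : BrouwerContinuity -> CountableChoice ->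
  (forall h w Psi, fresh h w ->
     (forall x, compat h x -> EE T (sect x w) -> AA T (Psi x)) ->
     exists s, stratA T h w Psi s) /\
  (forall h u Psi, fresh h u ->
     (forall x, compat h x -> AA T (sect x u) -> EE T (Psi x)) ->
     exists s, stratE T h u Psi s).
Proof.
move=> BCP CC; elim: T => [|F IH]; split=> h w Psi fr HPsi.
- by exists (fun=> 0).
(* [pt h] vanishes on a fresh cylinder, hence is in [AA Leaf] there. *)
- have [k Pk] : EE Leaf (Psi (pt h)).
    apply: HPsi (compat_pt h) _ => n.
    by apply: fresh_pt fr _; rewrite CodeSeq.codeK prefix_prefix.
  have [m Hm] := BCP_cont (fun x => Psi x (CodeSeq.code [:: k])) (pt h) BCP.
  (* The leaf event keeps [pt h] below the modulus [m]; the choice of 0 as the child left free is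
     arbitrary. *)
  exists (fun=> pickle (m, 0, true)), m, 0; rewrite pickleK.
  split=> // x [ag _].
  exists k; rewrite Hm // => s sm; rewrite -ag /= ?leq_max ?sm //.
  by case: ifP.
(* Choice ranges over all numbers [q]; the requirement is void unless [q] codes an admissible child
   and condition. *)
- have /CC.2 [G GP] q : exists s,
      if (unpickle q : option (nat * seq event)) is Some (i, h') then
        suffix h h' && fresh h' (rcons w i) ->
        stratE (F (idx i)) h' (rcons w i) (fun x => sect (Psi x) [:: i]) s
      else True.
    case: (unpickle q : option _) => [[i h']|]; last by exists (fun=> 0).
    have [/andP [hh' fh']|_] := boolP (_ && _); last by exists (fun=> 0).
    have [s Hs] : exists s, stratE (F (idx i)) h' (rcons w i)
        (fun x => sect (Psi x) [:: i]) s.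
      apply: (IH _).2 => // x cx Ai.
      suff /(_ i) : AA (Node F) (Psi x) by [].
      apply: HPsi (compat_suffix hh' cx) _; exists i.
      exact: eq_AA (fsym (@sect_rcons _ _ _)) Ai.
    by exists s.
  exists (fun t => if t is t'.+1 then
     if (unpickle t' : option (nat * seq event * nat)) is Some (i, h', r)
     then G (pickle (i, h')) r else 0
     else 1).
  split=> // i h' hh' fh'.
  have := GP (pickle (i, h')); rewrite pickleK hh' fh' => /(_ isT).
  by apply: (strat_ext _ _).2 => t; rewrite /substrat pickleK.
- have [m [j [j' [ejj' Hj]]]] := node_step BCP CC fr HPsi.
  have [|s Hs] := (IH (idx j)).1 (Some (w, (m, j, false)) :: h) (rcons w j)
    (fun x => sect (Psi x) [:: j']) _ Hj.
    by rewrite /= prefix_refl /= (fresh_prefix (prefix_rcons _ _) fr).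
  exists (fun t => if t is t'.+1 then s t' else pickle (m, j, false)), m, j.
  by rewrite pickleK; split=> //; exists j'.
Qed.

(** * The generic point of a strategy *)

(* Entry [n] is a pair [(w, s)] still to be served: [s] is the strategy for
   [AA] at [w]. Stage [k] serves child [i] of entry [n], where [k] codes
   [(n, i)], and creates entry [k.+1]. An entry whose strategy has value [0] at
   [0] sits at a leaf and is left alone. *)
Definition entry := option (seq nat * baire).

Definition serve (st : seq event * seq entry) (k : nat) : event * entry :=
  let: (n, i) := Cantor.of_nat k in
  if nth None st.2 n is Some (w, s) then
    let u := rcons w i in
    let s' := substrat i st.1 s in
    if s 0 == 0 then (None, None) else
    if unpickle (s' 0) is Some (m, j, b) then
      (Some (u, (m, j, b)),
       if b then None else Some (rcons u j, next_strat s'))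
    else (None, None)
  else (None, None).

Fixpoint run (h : seq event) (w : seq nat) (s : baire) (k : nat) :
    seq event * seq entry :=
  if k is k'.+1 then
    let st := run h w s k' in
    let ee := serve st k' in (ee.1 :: st.1, rcons st.2 ee.2)
  else (h, [:: Some (w, s)]).

Definition hist h w s k : seq event := (run h w s k).1.

Definition ent h w s n : entry := nth None (run h w s n).2 n.

(** Every stage lengthens the determined segment, so stage [t.+1] has fixed the value at [t]. *)
Definition limit h w s : baire := fun t => pt (hist h w s t.+1) t.

Lemma size_run h w s k : size (run h w s k).2 = k.+1.
Proof. by elim: k => //= k IHk; rewrite size_rcons IHk. Qed.

Lemma nth_run h w s k n : n <= k -> nth None (run h w s k).2 n = ent h w s n.
Proof.
elim: k => [|k IHk]; first by rewrite leqn0 => /eqP ->.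
rewrite leq_eqVlt => /orP [/eqP -> //|nk].
by rewrite /= nth_rcons size_run nk IHk.
Qed.

Lemma ent_succ h w s k : ent h w s k.+1 = (serve (run h w s k) k).2.
Proof. by rewrite /ent /= nth_rcons size_run ltnn eqxx. Qed.

Lemma hist_suffix h w s k l : k <= l -> suffix (hist h w s k) (hist h w s l).
Proof.
elim: l => [|l IHl]; first by rewrite leqn0 => /eqP ->; apply: suffix_refl.
rewrite leq_eqVlt => /orP [/eqP ->|/IHl kl]; first exact: suffix_refl.
exact: suffix_trans kl (suffix_suffix [:: _] _).
Qed.

Lemma len_hist h w s k : k <= len (hist h w s k).
Proof. by elim: k => //= k IHk; rewrite leq_max ltnS IHk orbT. Qed.

Lemma compat_limit h w s k : compat (hist h w s k) (limit h w s).
Proof.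
have lim t l : (t < len (hist h w s l)) || frozen (hist h w s l) t ->
    limit h w s t = pt (hist h w s l) t.
  move=> tl; rewrite /limit; case/orP: (leq_total l t.+1) => le.
    by rewrite (pt_suffix (hist_suffix h w s le)).
  by rewrite (pt_suffix (hist_suffix h w s le)) // len_hist.
by split=> t tl; [apply/esym|]; apply: lim; rewrite tl ?orbT.
Qed.

Lemma of_nat_le k n i : Cantor.of_nat k = (n, i) -> n <= k.
Proof.
move=> ek; rewrite -(Cantor.cancel_to_of k) ek.
exact: pairing_ge.
Qed.

(* An entry at a leaf reserves the whole cylinder for ever, under the dummy
   index [i = 0]. *)
Definition pending h w s k n i v : Prop :=
  n <= k /\ exists w' s', ent h w s n = Some (w', s') /\
    if s' 0 == 0 then v = w' /\ i = 0
    else v = rcons w' i /\ k <= pairing n i.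

(** An event at [u] keeps the other pending cylinders fresh because they are incomparable with [u];
    the new ones lie below the child it leaves free. *)
Lemma pending_fresh h w s k : fresh h w ->
  (forall n i v, pending h w s k n i v -> fresh (hist h w s k) v) /\
  (forall n i v n' i' v', pending h w s k n i v -> pending h w s k n' i' v' ->
     (n, i) <> (n', i') -> incomp v v').
Proof.
move=> fhw; have incomp_rcons (u : seq nat) i i' :
    i <> i' -> incomp (rcons u i) (rcons u i').
  move=> nii'; rewrite /incomp -!cats1 !prefix_catr // !prefix_cons eqxx /=.
  by rewrite !andbT [i' == i]eq_sym andbb; apply/eqP.
elim: k => [|k [IHf IHi]].
  have pend0 n i v : pending h w s 0 n i v ->
      n = 0 /\ if s 0 == 0 then v = w /\ i = 0 else v = rcons w i.
    case; rewrite leqn0 => /eqP -> [w' [s' [[<- <-]]]].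
    by case: ifP => // _ [].
  split=> [n i v /pend0 [_]|n i v n' i' v' /pend0 [-> +] /pend0 [-> +]].
    by case: ifP => _ [-> //]; apply: fresh_prefix (prefix_rcons _ _) fhw.
  case: ifP => _; first by move=> [_ ->] [_ ->].
  by move=> -> -> nii'; apply: incomp_rcons => eii'; rewrite eii' in nii'.
have pend_old n i v : n <= k ->
    pending h w s k.+1 n i v -> pending h w s k n i v.
  move=> nk [_ [w' [s' [en Hs']]]]; split=> //; exists w', s'; split=> //.
  by case: ifP Hs' => // _ [-> /ltnW].
case ek: (Cantor.of_nat k) => [n0 i0]; have n0k := of_nat_le ek.
have ek' : k = pairing n0 i0 by rewrite -(Cantor.cancel_to_of k) ek.
have := ent_succ h w s k; rewrite /hist /= -/(hist h w s k) /serve ek.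
rewrite nth_run // -/(hist h w s k).
have idle : ent h w s k.+1 = None ->
  (forall n i v, pending h w s k.+1 n i v -> fresh (None :: hist h w s k) v) /\
  (forall n i v n' i' v', pending h w s k.+1 n i v ->
     pending h w s k.+1 n' i' v' -> (n, i) <> (n', i') -> incomp v v').
  move=> ek1.
  have old n i v : pending h w s k.+1 n i v -> pending h w s k n i v.
    move=> p; apply: pend_old (p); case: p => + [w' [s' [en _]]].
    by rewrite leq_eqVlt => /orP [/eqP e|//]; rewrite e ek1 in en.
  split=> [n i v /old /IHf //|n i v n' i' v' /old p /old p'].
  exact: IHi p p'.
case en0: (ent h w s n0) => [[w0 s0]|]; last exact: idle.
have [s00|s00] := boolP (s0 0 == 0); first exact: idle.
case: (unpickle _) => [[[m j] b]|]; last exact: idle.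
set u := rcons w0 i0 => /= ek1 {idle}.
have pu : pending h w s k n0 i0 u.
  split=> //; exists w0, s0; split=> //; rewrite (negbTE s00); split=> //.
  by rewrite -ek'.
(* Stage [k] uses up the request [(n0, i0)], so a request of an older entry that is still pending is
   a different one. *)
have old n i v : n <= k -> pending h w s k.+1 n i v ->
    pending h w s k n i v /\ incomp u v.
  move=> nk p; have q := pend_old _ _ _ nk p; split=> //; apply: IHi pu q _.
  move=> [en ei]; case: p => _ [w' [s' []]]; rewrite -en en0 => - [<- <-].
  by rewrite (negbTE s00) -ei -ek' ltnn => - [].
have new n i v : k < n -> pending h w s k.+1 n i v ->
    [/\ prefix (rcons u j) v, n = k.+1 & forall i' v',
      pending h w s k.+1 n i' v' -> i <> i' -> incomp v v'].
  move=> kn [nk [w' [s' [en Hv]]]].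
  have {kn}nk : n = k.+1 by apply/eqP; rewrite eqn_leq nk.
  have [? ?] : w' = rcons u j /\ b = false.
    by move: ek1; rewrite -nk en; case: b => // - [].
  subst w' b n; split=> // [|i' v' [_ [w'' [s'' [en' ]]]]].
    by case: ifP Hv => _ [-> _]; rewrite ?prefix_refl ?prefix_rcons.
  move: en'; rewrite en => - [<- <-]; case: ifP Hv => _ [-> Hi] [-> Hi'] nii'.
    by rewrite Hi Hi' in nii'.
  exact: incomp_rcons.
have case_le n : n <= k \/ k < n by case: (leqP n k); [left | right].
split=> [n i v p|n i v n' i' v' p p' neq].
  rewrite /fresh /= -/(fresh _ _).
  case: (case_le n) => [nk|kn].
    by have [q uv] := old _ _ _ nk p; rewrite uv orbT (IHf _ _ _ q).
  have [uv _ _] := new _ _ _ kn p; rewrite uv.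
  exact: fresh_prefix (prefix_trans (prefix_rcons _ _) uv) (IHf _ _ _ pu).
case: (case_le n) => [nk|kn]; case: (case_le n') => [nk'|kn'].
- have [q _] := old _ _ _ nk p; have [q' _] := old _ _ _ nk' p'.
  exact: IHi q q' neq.
- have [_ uv] := old _ _ _ nk p; have [uv' _ _] := new _ _ _ kn' p'.
  rewrite incomp_sym; apply: incomp_prefix uv.
  exact: prefix_trans (prefix_rcons _ _) uv'.
- have [_ uv'] := old _ _ _ nk' p'; have [uv _ _] := new _ _ _ kn p.
  by apply: incomp_prefix uv'; apply: prefix_trans (prefix_rcons _ _) uv.
- have [_ en inc] := new _ _ _ kn p; have [_ en' _] := new _ _ _ kn' p'.
  have enn : n' = n by rewrite en en'.
  by rewrite enn in p' neq; apply: inc p' _ => ei; apply: neq; rewrite ei.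
Qed.

(** Induction on [T] for all entries and stages at once, since serving a child of an entry at a node
    creates a later entry. *)
Lemma limit_lead h w s T : BrouwerContinuity -> fresh h w ->
  (forall n w' s' Psi, ent h w s n = Some (w', s') ->
     stratA T (hist h w s n) w' Psi s' ->
     AA T (sect (limit h w s) w') /\ AA T (Psi (limit h w s))) /\
  (forall k n i w' s' Psi, Cantor.of_nat k = (n, i) ->
     ent h w s n = Some (w', s') -> s' 0 <> 0 ->
     stratE T (hist h w s k) (rcons w' i) Psi (substrat i (hist h w s k) s') ->
     EE T (sect (limit h w s) (rcons w' i)) /\ EE T (Psi (limit h w s))).
Proof.
move=> BCP fhw; pose x := limit h w s; rewrite -/x.
have xP k : compat (hist h w s k) x := compat_limit h w s k.
have pend k n i w' s' : Cantor.of_nat k = (n, i) ->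
    ent h w s n = Some (w', s') -> s' 0 <> 0 ->
    fresh (hist h w s k) (rcons w' i).
  move=> ek en /eqP s'0; apply: ((pending_fresh _ _ fhw).1 n i).
  split; first exact: of_nat_le ek.
  exists w', s'; rewrite (negbTE s'0); split=> //; split=> //.
  by rewrite /pairing -ek Cantor.cancel_to_of.
have step k n i w' s' d : Cantor.of_nat k = (n, i) ->
    ent h w s n = Some (w', s') -> s' 0 <> 0 ->
    unpickle (substrat i (hist h w s k) s' 0) = Some d ->
    hist h w s k.+1 = Some (rcons w' i, d) :: hist h w s k /\
    ent h w s k.+1 = if d.2 then None else
      Some (rcons (rcons w' i) d.1.2,
            next_strat (substrat i (hist h w s k) s')).
  move=> ek en /eqP s'0 ud.
  rewrite ent_succ /hist /= /serve ek nth_run; last exact: of_nat_le ek.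
  rewrite en (negbTE s'0) -/(hist h w s k) ud.
  by case: d {ud} => [[m j] b].
elim: T => [|F IH]; split.
- move=> n w' s' Psi en [s'0 HPsi].
  have fw k : n <= k -> fresh (hist h w s k) w'.
    move=> nk; apply: ((pending_fresh _ _ fhw).1 n 0).
    by split=> //; exists w', s'; rewrite s'0.
  (* The cylinder of a leaf entry stays fresh for ever, so the limit vanishes on it. *)
  split=> q.
    pose t0 := CodeSeq.code (w' ++ [:: q]).
    have [agx _] := xP (maxn n t0.+1).
    rewrite /sect CodeSeq.codeK -agx; last first.
      by apply: leq_trans (len_hist _ _ _ _); apply: leq_maxr.
    apply: fresh_pt (fw _ (leq_maxl _ _)) _.
    by rewrite CodeSeq.codeK prefix_prefix.
  have [M HM] := BCP_cont (fun y => Psi y (CodeSeq.code [:: q])) x BCP.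
  (* Changing [x] at one position past [M] and the finite segment puts the leaf into [EE], where the
     strategy's promise applies, without affecting the value of [Psi] at [q]. *)
  pose r := maxn M (len (hist h w s n)).
  pose t0 := CodeSeq.code (w' ++ [:: r]).
  pose y : baire := fun t => if t == t0 then 1 else x t.
  have r_lt : r < t0 by apply: mem_code_lt; rewrite mem_cat inE eqxx orbT.
  rewrite -(HM y) => [|t tM]; last first.
    rewrite /y; case: eqP => // et.
    have := leq_trans tM (leq_trans (leq_maxl _ _) (ltnW r_lt)).
    by rewrite et ltnn.
  apply: HPsi; last first.
    by exists r; rewrite /sect CodeSeq.codeK /y eqxx.
  have [agx frx] := xP n; split=> t Ht; rewrite /y; case: eqP => // et; auto.
    have := leq_trans Ht (leq_trans (leq_maxr M _) (ltnW r_lt)).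
    by rewrite et ltnn.
  rewrite (fresh_frozen (fw n (leqnn n))) // in Ht.
  by rewrite et CodeSeq.codeK prefix_prefix.
- move=> k n i w' s' Psi ek en s'0 [m [j [ud HPsi]]].
  have [hk _] := step _ _ _ _ _ _ ek en s'0 ud.
  have xk1 := xP k.+1; rewrite hk in xk1; split; last exact: HPsi.
  (* The child [q] differs from [j] and is so large that the event itself writes its value, namely
     1. *)
  pose q := maxn (maxn m (len (hist h w s k))) j.+1.
  exists q; rewrite /sect CodeSeq.codeK.
  set t0 := CodeSeq.code _.
  have q_lt : q < t0 by apply: mem_code_lt; rewrite mem_cat inE eqxx orbT.
  have pu : prefix (rcons w' i) (CodeSeq.decode t0).
    by rewrite CodeSeq.codeK prefix_prefix.
  have reg : region (Some (rcons w' i, (m, j, true))) (CodeSeq.decode t0).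
    rewrite /= pu CodeSeq.codeK -[rcons (rcons _ _) _]cats1 prefix_catr //.
    by rewrite prefix_cons eqxx /= andbT ltn_eqF // /q leq_maxr.
  have fk := pend _ _ _ _ _ ek en s'0.
  have [_ ->] := xk1; last by rewrite /frozen /= in reg *; rewrite reg.
  have le_m : m <= t0.
    by rewrite (leq_trans _ (ltnW q_lt)) // /q leq_max leq_max leqnn.
  have le_l : len (hist h w s k) <= t0.
    by rewrite (leq_trans _ (ltnW q_lt)) // /q leq_max leq_max leqnn orbT.
  rewrite /= in reg *; rewrite reg le_l (fresh_frozen fk pu) /= ltnNge le_m /=.
  by rewrite CodeSeq.codeK size_cat addKn /std.
- move=> n w' s' Psi en [s'0 Hs'].
  have Hi i : EE (F (idx i)) (sect x (rcons w' i)) /\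
              EE (F (idx i)) (sect (Psi x) [:: i]).
    have ek : Cantor.of_nat (pairing n i) = (n, i).
      exact: Cantor.cancel_of_to.
    apply: ((IH _).2 _ _ _ _ _ (fun y => sect (Psi y) [:: i]) ek en s'0).
    apply: Hs'.
      exact: hist_suffix (pairing_ge n i).
    exact: pend ek en s'0.
  split=> i; last exact: (Hi i).2.
  exact: eq_EE (fsym (@sect_rcons _ _ _)) (Hi i).1.
- move=> k n i w' s' Psi ek en s'0 [m [j [ud [j' ejj' Hs']]]].
  have [hk ek1] := step _ _ _ _ _ _ ek en s'0 ud.
  rewrite -hk in Hs'.
  have [Aw APsi] := (IH (idx j)).1 _ _ _ _ ek1 Hs'.
  split; [exists j | exists j'; rewrite ejj'] => //.
  exact: eq_AA (fsym (@sect_rcons _ _ _)) Aw.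
Qed.

(** * The hierarchy theorem on trees and its transfer to [Hrs] *)

Lemma generic T h w Psi s : BrouwerContinuity -> fresh h w ->
  stratA T h w Psi s ->
  exists x, [/\ compat h x, AA T (sect x w) & AA T (Psi x)].
Proof.
move=> BCP fhw Hs; exists (limit h w s).
have [|] := (limit_lead s T BCP fhw).1 0 w s Psi _ Hs; first by [].
by split=> //; apply: (compat_limit h w s 0).
Qed.

(** The first move picks a child [j] of the root; a generic point for the remaining strategy enters
    [AA] at [j] and its image does so at [j']. At a leaf the first move suffices. *)
Lemma AA_EE_meet T Psi : BrouwerContinuity -> CountableChoice ->
  (forall x, AA T x -> EE T (Psi x)) -> exists x, EE T x /\ EE T (Psi x).
Proof.
move=> BCP CC HPsi.
have [|x _ Ax|s] := (strat_exists T BCP CC).2 [::] [::] Psi.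
- by [].
- by apply: HPsi; apply: eq_AA Ax; apply: sect_nil.
case: T HPsi => [|F] HPsi [m [j [_]]].
  pose h : seq event := [:: Some ([::], (m, j, true))].
  move=> /(_ (pt h) (compat_pt h)) Ex; exists (pt h); split=> //.
  exists (maxn m j.+1); rewrite /= CodeSeq.codeK /= andbT.
  rewrite ltn_eqF ?leq_maxr //= ltnNge.
  by rewrite (leq_trans (leq_maxl m j.+1)) // ltnW // mem_code_lt // mem_head.
move=> [j' ejj' /(generic BCP)] [|x [_ Ax APsi]].
  by rewrite /fresh /= eqxx.
exists x; split; [exists j | exists j'; rewrite ejj'] => //.
Qed.

Lemma EE_AA_meet T Psi : BrouwerContinuity -> CountableChoice ->
  (forall x, EE T x -> AA T (Psi x)) -> exists x, AA T x /\ AA T (Psi x).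
Proof.
move=> BCP CC HPsi.
have [|x _ Ex|s] := (strat_exists T BCP CC).1 [::] [::] Psi.
- by [].
- by apply: HPsi; apply: eq_EE Ex; apply: sect_nil.
move=> /(generic BCP) [] // x [_ Ax APsi]; exists x; split=> //.
exact: eq_AA (sect_nil x) Ax.
Qed.

Theorem theorem3p19 :
  BrouwerContinuity -> CountableChoice ->
  (forall S : nat -> Prop, Hrs S -> forall phi : cfun,
     (forall a : baire, leadA S a -> leadE S (capp phi a)) ->
     exists a : baire, leadE S a /\ leadE S (capp phi a))
  /\
  (forall S : nat -> Prop, Hrs S -> forall phi : cfun,
     (forall a : baire, leadE S a -> leadA S (capp phi a)) ->
     exists a : baire, leadA S a /\ leadA S (capp phi a)).
Proof.
move=> BCP CC; split=> S /(Hrs_coded CC) [c /tree_of_coded [T TP]] phi Hphi.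
  have [x Ax|x [Ex Ephi]] := @AA_EE_meet T (capp phi) BCP CC.
    by apply/(TP _).1/Hphi/(TP _).2.
  by exists x; split; apply/(TP _).1.
have [x Ex|x [Ax Aphi]] := @EE_AA_meet T (capp phi) BCP CC.
  by apply/(TP _).2/Hphi/(TP _).1.
by exists x; split; apply/(TP _).2.
Qed.
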